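(* Let $\alpha,\gamma>0$ and $\kappa\in\mathbb{Z}$. The optimal solution $\hat\Phi^\psi_\kappa,\hat\Phi^u_\kappa$ to the problem $$\arg\min_{\hat\Phi^\psi_\kappa,\hat\Phi^u_\kappa\in\mathcal{RH}_2}\left\|\begin{bmatrix}\gamma&0\\0&1\end{bmatrix}\begin{bmatrix}\hat\Phi^\psi_\kappa\\\hat\Phi^u_\kappa\end{bmatrix}\right\|_{\mathcal{H}_2}\quad\text{s.t.}\quad \big((s+1)-(-\alpha\kappa^2+1)\big)\hat\Phi^\psi_\kappa(s)-\hat\Phi^u_\kappa(s)=1$$ is given by $$\hat\Phi^\psi_\kappa(s)=\left(s+\sqrt{\gamma^2+\alpha^2\kappa^4}\right)^{-1},\qquad \hat\Phi^u_\kappa(s)=\frac{\alpha\kappa^2-\sqrt{\gamma^2+\alpha^2\kappa^4}}{s+\sqrt{\gamma^2+\alpha^2\kappa^4}}.$$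
   Context: $\mathcal{RH}_2$ is the set of (here single-input single-output) rational transfer functions that are strictly proper and have no poles in the closed right half plane. $\|\cdot\|_{\mathcal{H}_2}$ is the standard $\mathcal{H}_2$ norm of a stable strictly proper finite-dimensional transfer matrix, i.e. $\|H\|_{\mathcal{H}_2}^2=\frac1{2\pi}\int_{-\infty}^\infty \mathrm{Tr}(H(j\omega)^*H(j\omega))\,d\omega$. The affine constraint is an identity of rational functions of $s$. *)

(* Defs.v *)
From mathcomp Require Import all_boot all_order all_algebra.
From mathcomp Require Import all_classical all_reals all_analysis.
From mathcomp Require Import complex.

Set Implicit Arguments.
Unset Strict Implicit.
Unset Printing Implicit Defensive.

Import Order.TTheory GRing.Theory Num.Theory.
Import numFieldNormedType.Exports.

Local Open Scope classical_set_scope.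
Local Open Scope ring_scope.
Local Open Scope complex_scope.

Definition argmin (T : Type) (d : Order.disp_t) (V : porderType d)
    (S : set T) (J : T -> V) : set T :=
  [set x | S x /\ forall y, S y -> (J x <= J y)%O].

(* Coefficients are complex: spatial Fourier coefficients of a real system
   need not be real-rational. *)
Notation ratfun R := {fraction {poly R[i]}}.

Section RationalTransferFunctions.
Variable R : realType.
Implicit Types H : ratfun R.

Definition rat_of_poly (p : {poly R[i]}) : ratfun R := tofrac p.

Definition rat_const (c : R) : ratfun R := rat_of_poly (c%:C)%:P.

Definition rat_s : ratfun R := rat_of_poly 'X.

(* [repr H] is an arbitrary representative of the fraction, hence the division
   by the gcd; the reduced pair is determined by H up to a common nonzero
   constant factor. *)
Definition rat_num H : {poly R[i]} :=
  let f := repr H in (frac f).1 %/ gcdp (frac f).1 (frac f).2.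

Definition rat_den H : {poly R[i]} :=
  let f := repr H in (frac f).2 %/ gcdp (frac f).1 (frac f).2.

Definition is_pole H (z : R[i]) : Prop := root (rat_den H) z.

Definition strictly_proper H : Prop :=
  (size (rat_num H) < size (rat_den H))%N.

Definition RH2 : set (ratfun R) :=
  [set H : ratfun R | strictly_proper H /\ forall z, 0 <= complex.Re z -> ~ is_pole H z].

(* Meaningful when z is not a pole of H. *)
Definition rat_eval H (z : R[i]) : R[i] :=
  (rat_num H).[z] / (rat_den H).[z].

Definition freq_response (m n : nat) (H : 'M[ratfun R]_(m, n)) (w : R) :
    'M[R[i]]_(m, n) :=
  map_mx (fun h => rat_eval h (0 +i* w)) H.

(* The trace of A^* A is real and nonnegative; [complex.Re] only changes its
   type from R[i] to R. *)
Definition frobenius_sqr (m n : nat) (A : 'M[R[i]]_(m, n)) : R :=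
  complex.Re (\tr ((map_mx (@conjc R) A)^T *m A)).

(* Valued in \bar R, so that no integrability convention is involved. *)
Definition H2norm (m n : nat) (H : 'M[ratfun R]_(m, n)) : \bar R :=
  ((((2 * pi)^-1)%:E *
    \int[@lebesgue_measure R]_w (frobenius_sqr (freq_response H w))%:E)
  `^ 2^-1)%E.

End RationalTransferFunctions.

Arguments RH2 {R}.
Arguments rat_s {R}.

(* Main.v *)
(* Write a = alpha k^2. By the affine constraint a feasible pair is determined
   by psi, and psi = 1/(s+r) + h gives u = (a-r)/(s+r) + (s+a) h.  On the
   imaginary axis the choice r^2 = gamma^2 + a^2 turns the cross terms of the
   cost into 2 (r-a) Re h(jw), and the quadratic ones into (w^2+r^2)|h(jw)|^2.
   Since (s+a) h is strictly proper, h has relative degree at least 2, and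
   stability then makes the integral of h over the imaginary axis vanish; so
   the excess cost is the integral of (w^2+r^2)|h(jw)|^2.

   The vanishing of that integral is shown without contour integration: by the
   resolvent identity, such an h is a combination of powers g_p^k (k >= 2) and of
   differences g_p - g_q, where g_p(s) = 1/(s-p) with Re p < 0, and these have
   explicit primitives on the axis. *)

Require Import Defs.
From mathcomp Require Import all_boot all_order all_algebra.
From mathcomp Require Import all_classical all_reals all_analysis.
From mathcomp Require Import measurable_realfun complex.
From mathcomp Require Import ring lra zify.

Set Implicit Arguments.
Unset Strict Implicit.
Unset Printing Implicit Defensive.

Import Order.TTheory GRing.Theory Num.Theory.
Import numFieldNormedType.Exports.

Local Open Scope classical_set_scope.
Local Open Scope ring_scope.

(** * Real functions of quadratic decay and their integrals over the line *)

Section QuadraticDecay.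
Variable R : realType.
Local Notation mu := (@lebesgue_measure R).
Implicit Types f g : R -> R.

(** Continuity serves measurability and the fundamental theorem of calculus; the bound serves
    integrability on the whole line. *)
Definition quad_decay f :=
  continuous f /\ exists C, forall x, `|f x| <= C / (1 + x ^+ 2).

Lemma onePsqr_gt0 (x : R) : 0 < 1 + x ^+ 2.
Proof. by rewrite ltr_pwDl// sqr_ge0. Qed.

Lemma continuous_onePsqrV : continuous (fun x : R => (1 + x ^+ 2)^-1).
Proof. exact: (@continuous_oneDsqrV R). Qed.

Lemma measurable_fun_continuous_EFin f :
  continuous f -> measurable_fun setT (EFin \o f).
Proof.
move=> cf; apply/measurable_EFinP; exact: continuous_measurable_fun.
Qed.

Lemma integrable_onePsqrV : mu.-integrable setT (fun x => ((1 + x ^+ 2)^-1)%:E).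
Proof.
apply/integrableP; split.
  exact: measurable_fun_continuous_EFin continuous_onePsqrV.
under eq_integral => x _.
  rewrite abse_EFin ger0_norm ?invr_ge0 ?(ltW (onePsqr_gt0 _))//; over.
rewrite ge0_symfun_integralT.
- rewrite -set_itvcy (integral0y_oneDsqr R) -EFinM; exact: ltry.
- by move=> x; rewrite invr_ge0 (ltW (onePsqr_gt0 _)).
- exact: continuous_onePsqrV.
- by move=> x /=; rewrite sqrrN.
Qed.

Lemma quad_decay_integrable f :
  quad_decay f -> mu.-integrable setT (EFin \o f).
Proof.
move=> [cf [C fC]].
have iC : mu.-integrable setT (fun x => (C / (1 + x ^+ 2))%:E).
  have := integrableZl measurableT C integrable_onePsqrV.
  by apply: eq_integrable.
apply: le_integrable iC => //.
- by exact: measurable_fun_continuous_EFin.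
- by move=> x _; rewrite /= !lee_fin (le_trans (fC x))// ler_norm.
Qed.

Lemma quad_decay_linear a b f g : quad_decay f -> quad_decay g ->
  quad_decay (fun x => a * f x + b * g x).
Proof.
move=> [cf [C fC]] [cg [D gD]]; split.
  by move=> x; apply: cvgD; apply: cvgM => //; first [exact: cvg_cst|exact: cf|exact: cg].
exists (`|a| * C + `|b| * D) => x; rewrite (le_trans (ler_normD _ _))// !normrM.
by rewrite mulrDl -!mulrA lerD// ler_wpM2l.
Qed.

(** Dominated convergence, with [|f|] as the dominating function, along the truncations to
    [[-n, n]]. Only the symmetric increment of [F] has to converge, so logarithmic primitives are
    allowed. *)
Lemma quad_decay_integral_FTC f (F : R -> R) : quad_decay f ->
  (forall x : R, is_derive x (1 : R) F (f x)) ->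
  F n%:R - F (- n%:R) @[n --> \oo] --> (0 : R) ->
  (\int[mu]_x (f x)%:E = 0)%E.
Proof.
move=> qf dF F0; have [cf _] := qf.
pose fn (n : nat) := (EFin \o f) \_ `[- n%:R, n%:R].
have mf : measurable_fun setT (EFin \o f).
  by exact: measurable_fun_continuous_EFin.
have [|||||] := @dominated_convergence _ _ _ mu _ measurableT fn (EFin \o f)
    (fun x => `|(f x)%:E|%E).
- move=> n; rewrite /fn; apply/(measurable_restrictT _ _).1 => //.
  exact: measurable_funS mf.
- exact: mf.
- apply: aeW => x _; apply: cvg_near_cst.
  near=> n; rewrite /fn patchE mem_set//= in_itv/=.
  by rewrite -ler_norml; near: n; exact: nbhs_infty_ger.
- by apply: integrable_abse; exact: quad_decay_integrable.
- apply: aeW => x n _; rewrite /fn patchE; case: ifP => // _.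
  by rewrite abse0 abse_ge0.
move=> _ _ cvgf; apply: cvg_unique cvgf _ => //.
(* The fundamental theorem is applied on a nondegenerate interval, hence [0 < n]; the limit ignores
   [n = 0]. *)
have intfn n : (0 < n)%N -> (\int[mu]_x fn n x = (F n%:R - F (- n%:R))%:E)%E.
  move=> n0; rewrite /fn -integral_mkcond.
  have dF' x : derivable F x 1 by apply: ex_derive.
  have cF : continuous F.
    by move=> x; apply: differentiable_continuous; exact/derivable1_diffP.
  rewrite (@continuous_FTC2 _ f F) ?EFinB//.
  - by rewrite gtrN// ltr0n.
  - by apply: continuous_subspaceT.
  - split=> //; first by apply: cvg_at_right_filter; exact: cF.
    by apply: cvg_at_left_filter; exact: cF.
  - by move=> x _; rewrite derive1E; apply: derive_val.
apply/fine_cvgP; split.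
  by near=> n; rewrite /= intfn//; near: n; exact: nbhs_infty_gt.
apply: cvg_trans F0; apply: near_eq_cvg; near=> n.
by rewrite /= intfn//; near: n; exact: nbhs_infty_gt.
Unshelve. all: by end_near. Qed.
End QuadraticDecay.

(** * Resolvents [1/(jw - p)] on the imaginary axis: decay, derivatives, primitives *)

Section ResolventFunctions.
Variable R : realType.
Local Notation mu := (@lebesgue_measure R).
Local Notation Re := (@complex.Re R).
Local Notation Im := (@complex.Im R).
Implicit Types (f g : R -> R[i]) (p q z : R[i]).

(** The squared modulus valued in [R]; the norm of [R[i]] is valued in [R[i]] itself. *)
Definition sqnorm z : R := Re z ^+ 2 + Im z ^+ 2.

Lemma Re_add z1 z2 : Re (z1 + z2) = Re z1 + Re z2.
Proof. by case: z1 z2 => ? ? []. Qed.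

Lemma Im_add z1 z2 : Im (z1 + z2) = Im z1 + Im z2.
Proof. by case: z1 z2 => ? ? []. Qed.

Lemma Re_opp z : Re (- z) = - Re z. Proof. by case: z. Qed.

Lemma Im_opp z : Im (- z) = - Im z. Proof. by case: z. Qed.

Lemma Re_mul z1 z2 : Re (z1 * z2) = Re z1 * Re z2 - Im z1 * Im z2.
Proof. by case: z1 z2 => ? ? []. Qed.

Lemma Im_mul z1 z2 : Im (z1 * z2) = Re z1 * Im z2 + Im z1 * Re z2.
Proof. by case: z1 z2 => ? ? []. Qed.

Lemma sqnormM z1 z2 : sqnorm (z1 * z2) = sqnorm z1 * sqnorm z2.
Proof. rewrite /sqnorm Re_mul Im_mul; ring. Qed.

Lemma sqnorm_ge0 z : 0 <= sqnorm z.
Proof. by rewrite addr_ge0 ?sqr_ge0. Qed.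

Lemma sqnorm_eq0 z : (sqnorm z == 0) = (z == 0).
Proof. by rewrite /sqnorm paddr_eq0 ?sqr_ge0// !sqrf_eq0 eq_complex. Qed.

(* [sqdecay k f] says that |f(w)| is O((1 + w^2)^(-k/2)). *)
Definition sqdecay k f :=
  exists C, forall w, sqnorm (f w) <= C * ((1 + w ^+ 2)^-1) ^+ k.

Lemma sqdecayM k l f g : sqdecay k f -> sqdecay l g ->
  sqdecay (k + l) (fun w => f w * g w).
Proof.
move=> [C fC] [D gD]; exists (C * D) => w.
by rewrite sqnormM exprD mulrACA ler_pM ?sqnorm_ge0.
Qed.

Lemma sqdecay_le k l f : (k <= l)%N -> sqdecay l f -> sqdecay k f.
Proof.
move=> kl [C fC]; exists `|C| => w; rewrite (le_trans (fC w))//.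
rewrite (le_trans (ler_wpM2r _ (ler_norm C)))//.
  by rewrite exprn_ge0// invr_ge0 (ltW (onePsqr_gt0 w)).
rewrite ler_wpM2l// ler_wiXn2l// ?invr_ge0 ?(ltW (onePsqr_gt0 w))//.
by rewrite invf_le1 ?onePsqr_gt0// lerDl sqr_ge0.
Qed.

Lemma sqdecay_cst c : sqdecay 0 (fun=> c).
Proof. by exists (sqnorm c) => w; rewrite expr0 mulr1. Qed.

Lemma sqdecayX k f n : sqdecay k f -> sqdecay (n * k) (fun w => f w ^+ n).
Proof.
move=> fk; elim: n => [|n IHn].
  by under [X in sqdecay _ X]funext do rewrite expr0; exact: sqdecay_cst.
by under [X in sqdecay _ X]funext do rewrite exprS; rewrite mulSn; exact: sqdecayM.
Qed.

(** Taken componentwise, so that the real fundamental theorem applies to each part. *)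
Definition is_deriveC f (f' : R -> R[i]) := forall x : R,
  is_derive x (1 : R) (Re \o f) (Re (f' x)) /\
  is_derive x (1 : R) (Im \o f) (Im (f' x)).

Lemma is_deriveC_linear a b f f' g g' : is_deriveC f f' -> is_deriveC g g' ->
  is_deriveC (fun w => a * f w + b * g w) (fun w => a * f' w + b * g' w).
Proof.
move=> df dg x; have [Df1 Df2] := df x; have [Dg1 Dg2] := dg x.
rewrite !(Re_add, Im_add, Re_mul, Im_mul); split.
  rewrite [X in is_derive _ _ X _](_ : _ =
    (fun w => Re a * (Re \o f) w - Im a * (Im \o f) w +
              (Re b * (Re \o g) w - Im b * (Im \o g) w))); last first.
    by apply/funext => w /=; rewrite Re_add !Re_mul.
  by apply: is_derive_eq.
rewrite [X in is_derive _ _ X _](_ : _ =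
  (fun w => Re a * (Im \o f) w + Im a * (Re \o f) w +
            (Re b * (Im \o g) w + Im b * (Re \o g) w))); last first.
  by apply/funext => w /=; rewrite Im_add !Im_mul.
by apply: is_derive_eq.
Qed.

Lemma is_deriveCM f f' g g' : is_deriveC f f' -> is_deriveC g g' ->
  is_deriveC (fun w => f w * g w) (fun w => f' w * g w + f w * g' w).
Proof.
move=> df dg x; have [Df1 Df2] := df x; have [Dg1 Dg2] := dg x.
rewrite !(Re_add, Im_add, Re_mul, Im_mul); split.
  rewrite [X in is_derive _ _ X _](_ : _ =
    (fun w => (Re \o f) w * (Re \o g) w - (Im \o f) w * (Im \o g) w)); last first.
    by apply/funext => w /=; rewrite Re_mul.
  by apply: is_derive_eq; rewrite /= /GRing.scale /=; ring.
rewrite [X in is_derive _ _ X _](_ : _ =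
  (fun w => (Re \o f) w * (Im \o g) w + (Im \o f) w * (Re \o g) w)); last first.
  by apply/funext => w /=; rewrite Im_mul.
by apply: is_derive_eq; rewrite /= /GRing.scale /=; ring.
Qed.

Definition resolvent p (w : R) : R[i] := ((0 +i* w)%C - p)^-1.

(** This is [|jw - p|^2], the common denominator of both parts of the resolvent. *)
Definition sqdist p (w : R) : R := Re p ^+ 2 + (w - Im p) ^+ 2.

Lemma sqdist_gt0 p w : Re p < 0 -> 0 < sqdist p w.
Proof.
by move=> p0; rewrite ltr_pwDl ?sqr_ge0// exprn_even_gt0//= lt_eqF.
Qed.

Lemma Re_resolvent p w : Re (resolvent p w) = - Re p / sqdist p w.
Proof. by case: p => a b; rewrite /resolvent /sqdist /= sub0r sqrrN. Qed.

Lemma Im_resolvent p w : Im (resolvent p w) = - (w - Im p) / sqdist p w.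
Proof. by case: p => a b; rewrite /resolvent /sqdist /= sub0r sqrrN mulNr. Qed.

Lemma sqnorm_resolvent p w : Re p < 0 ->
  sqnorm (resolvent p w) = (sqdist p w)^-1.
Proof.
move=> p0; have := lt0r_neq0 (sqdist_gt0 w p0).
rewrite /sqnorm Re_resolvent Im_resolvent => D0.
by rewrite !exprMn -mulrDl !sqrrN -/(sqdist p w); field.
Qed.

Lemma sqdistV_le p : Re p < 0 ->
  exists2 C, 0 <= C & forall w, (sqdist p w)^-1 <= C / (1 + w ^+ 2).
Proof.
move=> p0; pose a := Re p; pose b := Im p.
have a2 : 0 < a ^+ 2 by rewrite exprn_even_gt0//= lt_eqF.
have b2 : 0 <= (1 + 2 * b ^+ 2) / a ^+ 2.
  by rewrite divr_ge0 ?sqr_ge0// addr_ge0// mulr_ge0// sqr_ge0.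
(* From [w^2 <= 2 (w - b)^2 + 2 b^2]: the summand 2 covers [2 (w - b)^2], and the quotient covers
   [1 + 2 b^2] because [a^2 <= sqdist p w]. *)
exists (2 + (1 + 2 * b ^+ 2) / a ^+ 2) => [|w]; first by rewrite addr_ge0.
rewrite ler_pdivlMr ?onePsqr_gt0// ler_pdivrMl ?sqdist_gt0//.
have -> : sqdist p w * (2 + (1 + 2 * b ^+ 2) / a ^+ 2) =
  1 + w ^+ 2 + (2 * a ^+ 2 + (w - 2 * b) ^+ 2
    + (w - b) ^+ 2 * ((1 + 2 * b ^+ 2) / a ^+ 2)).
  by rewrite /sqdist -/a -/b; field; rewrite lt_eqF.
rewrite lerDl addr_ge0//; first by rewrite addr_ge0 ?sqr_ge0// mulr_ge0// sqr_ge0.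
by rewrite mulr_ge0 ?sqr_ge0.
Qed.

Lemma sqdecay_resolvent p : Re p < 0 -> sqdecay 1 (resolvent p).
Proof.
move=> p0; have [C C0 hC] := sqdistV_le p0.
by exists C => w; rewrite expr1 sqnorm_resolvent.
Qed.

Lemma is_derive_sqdist p (w : R) :
  is_derive w (1 : R) (sqdist p) (2 * (w - Im p)).
Proof.
rewrite /sqdist; apply: is_derive_eq.
by rewrite /GRing.scale /=; ring.
Qed.

(** The factor ['i] is the chain rule: the derivative is along [w], not along [s = jw]. *)
Lemma is_deriveC_resolvent p : Re p < 0 ->
  is_deriveC (resolvent p) (fun w => - 'i%C * resolvent p w ^+ 2).
Proof.
move=> p0 w; have D0 := lt0r_neq0 (sqdist_gt0 w p0).
have dD := is_derive_sqdist p w.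
rewrite !(Re_mul, Im_mul, Re_opp, Im_opp, expr2) !Re_resolvent !Im_resolvent /=; split.
  rewrite [X in is_derive _ _ X _](_ : _ = (fun w => - Re p * (sqdist p w)^-1)).
    apply: is_derive_eq.
    by rewrite /GRing.scale /=; field.
  by apply/funext => v /=; rewrite Re_resolvent.
rewrite [X in is_derive _ _ X _](_ : _ =
    (fun w => - (w - Im p) * (sqdist p w)^-1)).
  apply: is_derive_eq.
  rewrite /GRing.scale /=; move: D0; rewrite /sqdist => D0.
  by field.
by apply/funext => v /=; rewrite Im_resolvent.
Qed.

(** Decay is bundled with the value because additivity of the integral asks for integrable
    summands. *)
Definition zero_integral (f : R -> R) :=
  quad_decay f /\ (\int[mu]_x (f x)%:E = 0)%E.

Definition zero_integralC f :=
  zero_integral (Re \o f) /\ zero_integral (Im \o f).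

Lemma zero_integral_linear (a b : R) (f g : R -> R) :
  zero_integral f -> zero_integral g ->
  zero_integral (fun x => a * f x + b * g x).
Proof.
move=> [qf f0] [qg g0]; split; first exact: quad_decay_linear.
have [If Ig] := (quad_decay_integrable qf, quad_decay_integrable qg).
under eq_integral do rewrite EFinD !EFinM.
rewrite integralD//; [|exact: integrableZl..].
by rewrite !integralZl// f0 g0 !mule0 adde0.
Qed.

Lemma zero_integralC_linear (a b : R[i]) f g :
  zero_integralC f -> zero_integralC g ->
  zero_integralC (fun w => a * f w + b * g w).
Proof.
move=> [f1 f2] [g1 g2]; split.
  rewrite [X in zero_integral X](_ : _ = (fun w =>
      1 * (Re a * (Re \o f) w + - Im a * (Im \o f) w) +
      1 * (Re b * (Re \o g) w + - Im b * (Im \o g) w))).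
    by apply: zero_integral_linear; exact: zero_integral_linear.
  by apply/funext => w /=; rewrite Re_add !Re_mul !mul1r !mulNr.
rewrite [X in zero_integral X](_ : _ = (fun w =>
    1 * (Re a * (Im \o f) w + Im a * (Re \o f) w) +
    1 * (Re b * (Im \o g) w + Im b * (Re \o g) w))).
  by apply: zero_integral_linear; exact: zero_integral_linear.
by apply/funext => w /=; rewrite Im_add !Im_mul !mul1r.
Qed.

Lemma is_derive_continuous (f f' : R -> R) :
  (forall x, is_derive x (1 : R) f (f' x)) -> continuous f.
Proof.
move=> df x; apply: differentiable_continuous.
by apply/derivable1_diffP; exact: ex_derive.
Qed.

(** [1 + |C|] replaces a square root of [C], as [C <= (1 + |C|)^2]. *)
Lemma sqr_le_norm_le (x C v : R) : 0 <= v -> x ^+ 2 <= C * v ^+ 2 ->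
  `|x| <= (1 + `|C|) * v.
Proof.
move=> v0 xC; rewrite -ler_sqr ?nnegrE ?mulr_ge0 ?addr_ge0//.
rewrite real_normK ?num_real// (le_trans xC)// exprMn ler_wpM2r ?sqr_ge0//.
have := ler_norm C; have := normr_ge0 C; nra.
Qed.

(** [f'] provides the continuity of [f], and [sqdecay 2] the quadratic bound on each component. *)
Lemma zero_integralC_FTC f f' F : sqdecay 2 f -> is_deriveC f f' ->
  is_deriveC F f ->
  Re (F n%:R) - Re (F (- n%:R)) @[n --> \oo] --> (0 : R) ->
  Im (F n%:R) - Im (F (- n%:R)) @[n --> \oo] --> (0 : R) ->
  zero_integralC f.
Proof.
move=> [C fC] df dF F1 F2.
have v0 (w : R) : 0 <= (1 + w ^+ 2)^-1 by rewrite invr_ge0 ltW ?onePsqr_gt0.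
have qRe : quad_decay (Re \o f).
  split; first by apply: is_derive_continuous => x; have [h _] := df x; exact: h.
  exists (1 + `|C|) => w; apply: sqr_le_norm_le => //=.
  by rewrite (le_trans _ (fC w))// /sqnorm lerDl sqr_ge0.
have qIm : quad_decay (Im \o f).
  split; first by apply: is_derive_continuous => x; have [_ h] := df x; exact: h.
  exists (1 + `|C|) => w; apply: sqr_le_norm_le => //=.
  by rewrite (le_trans _ (fC w))// /sqnorm lerDr sqr_ge0.
split; split => //.
  by apply: (@quad_decay_integral_FTC _ _ (Re \o F)) => // x; case: (dF x).
by apply: (@quad_decay_integral_FTC _ _ (Im \o F)) => // x; case: (dF x).
Qed.

Lemma cvg0_sqr_le (u : R ^nat) C :
  (forall n, u n ^+ 2 <= C / (1 + n%:R ^+ 2)) -> u n @[n --> \oo] --> (0 : R).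
Proof.
move=> uC; rewrite -cvg_shiftS; apply/norm_cvg0P.
apply: (@squeeze_cvgr _ _ _ _ (cst 0) (fun n => (1 + `|C|) * n.+1%:R^-1)).
- apply: nearW => n; rewrite normr_ge0/= -[`|C|]normr_id sqr_le_norm_le//.
  apply: le_trans (uC _) _; apply: le_trans (ler_wpM2r _ (ler_norm C)) _.
    by rewrite invr_ge0 ltW ?onePsqr_gt0.
  rewrite ler_wpM2l// exprVn lef_pV2 ?posrE ?onePsqr_gt0 ?exprn_gt0//.
  by rewrite lerDr.
- exact: cvg_cst.
- by rewrite -[X in _ --> X](mulr0 (1 + `|C|)); apply: cvgM;
    [exact: cvg_cst|exact: cvg_harmonic].
Qed.

Lemma sqdecay_increment_cvg0 F : sqdecay 1 F ->
  Re (F n%:R) - Re (F (- n%:R)) @[n --> \oo] --> (0 : R) /\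
  Im (F n%:R) - Im (F (- n%:R)) @[n --> \oo] --> (0 : R).
Proof.
move=> [C FC].
have FC' (n : nat) : sqnorm (F n%:R) <= C / (1 + n%:R ^+ 2) /\
    sqnorm (F (- n%:R)) <= C / (1 + n%:R ^+ 2).
  by split; rewrite (le_trans (FC _))// expr1 ?sqrrN.
split; rewrite -[X in _ --> X](subr0 0); apply: cvgB; apply: (@cvg0_sqr_le _ C) => n;
  have [h1 h2] := FC' n; by [apply: le_trans h1; rewrite /sqnorm ?lerDl ?lerDr sqr_ge0
    |apply: le_trans h2; rewrite /sqnorm ?lerDl ?lerDr sqr_ge0].
Qed.

Lemma is_deriveC_resolventX p n : Re p < 0 ->
  is_deriveC (fun w => resolvent p w ^+ n)
    (fun w => n%:R * - 'i%C * resolvent p w ^+ n.+1).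
Proof.
move=> p0; elim: n => [|n IHn].
  move=> x; rewrite !mul0r; split.
    by rewrite [X in is_derive _ _ X _](_ : _ = cst 1)//; exact: is_derive_cst.
  by rewrite [X in is_derive _ _ X _](_ : _ = cst 0)//; exact: is_derive_cst.
under [X in is_deriveC X _]funext do rewrite exprS.
have := is_deriveCM (is_deriveC_resolvent p0) IHn.
by congr is_deriveC; apply/funext => w; rewrite -natr1 !exprS; ring.
Qed.

(** From exponent 2 on, a power is up to a constant the derivative of the preceding power, which
    tends to 0 at both ends. *)
Lemma zero_integralC_resolventX p n : Re p < 0 ->
  zero_integralC (fun w => resolvent p w ^+ n.+2).
Proof.
move=> p0; pose c : R[i] := (n.+1%:R * - 'i%C)^-1.
have c0 : n.+1%:R * - 'i%C != 0 :> R[i].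
  by rewrite mulf_neq0 ?pnatr_eq0// oppr_eq0 eq_complex /= oner_eq0 andbF.
have dX m := is_deriveC_resolventX m p0.
(* A linear combination with second coefficient 0 serves as scaling by [c]; the same device recurs
   below. *)
have dF := is_deriveC_linear c 0 (dX n.+1) (dX n.+1).
have decF : sqdecay 1 (fun w => c * resolvent p w ^+ n.+1 + 0 * resolvent p w ^+ n.+1).
  under [X in sqdecay _ X]funext do rewrite mul0r addr0.
  apply: (@sqdecay_le _ (0 + n.+1 * 1)); first by rewrite muln1.
  by apply: sqdecayM; [exact: sqdecay_cst|apply: sqdecayX; exact: sqdecay_resolvent].
have [F1 F2] := sqdecay_increment_cvg0 decF.
apply: zero_integralC_FTC (dX _) _ F1 F2.
  apply: (@sqdecay_le _ (n.+2 * 1)); first by rewrite muln1.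
  by apply: sqdecayX; exact: sqdecay_resolvent.
move: dF; congr is_deriveC; apply/funext => w.
by rewrite mul0r addr0 mulrA mulVf// mul1r.
Qed.

Lemma cvgy_affine (b c : R) : 0 < c -> (n%:R + b) / c @[n --> \oo] --> +oo.
Proof.
move=> c0; apply/cvgryPge => A; near=> n.
rewrite ler_pdivlMr// -lerBlDr; near: n; exact: nbhs_infty_ger.
Unshelve. all: by end_near. Qed.

(** This is [-j Log(jw - p)] with the principal logarithm: for [Re p < 0] the point [jw - p] lies in
    the right half plane, where the argument is an arctangent. *)
Definition resolvent_primitive p (w : R) : R[i] :=
  (atan ((w - Im p) / - Re p) +i* (- (2^-1 * ln (sqdist p w))))%C.

Lemma is_deriveC_resolvent_primitive p : Re p < 0 ->
  is_deriveC (resolvent_primitive p) (resolvent p).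
Proof.
move=> p0 w; have D0 := sqdist_gt0 w p0.
have D1 := lt0r_neq0 D0.
have dD := is_derive_sqdist p w.
rewrite Re_resolvent Im_resolvent; split.
  rewrite [X in is_derive _ _ X _](_ : _ =
    atan \o (fun w => (w - Im p) / - Re p))//.
  have dA : is_derive w (1 : R) (fun w => (w - Im p) / - Re p) (- Re p)^-1.
    apply: is_derive_eq; rewrite /GRing.scale /=; ring.
  apply: is_derive_eq.
  have a0 : Re p != 0 by rewrite lt_eqF.
  have -> : 1 + ((w - Im p) / - Re p) ^+ 2 = sqdist p w / Re p ^+ 2.
    by rewrite /sqdist; field.
  by field; rewrite a0 D1.
rewrite [X in is_derive _ _ X _](_ : _ =
    (fun v => - (2^-1 * (@ln R \o sqdist p) v)))//.
have dL := is_derive1_ln D0.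
apply: is_derive_eq.
by rewrite /GRing.scale /=; field.
Qed.

(** The limits do not depend on [p], so they cancel in a difference of two resolvents. The argument
    of [jw - p] turns by [pi], while the ratio of the distances at [-n] and [n] tends to 1. *)
Lemma resolvent_primitive_cvg p : Re p < 0 ->
  Re (resolvent_primitive p n%:R) - Re (resolvent_primitive p (- n%:R))
    @[n --> \oo] --> pi /\
  Im (resolvent_primitive p n%:R) - Im (resolvent_primitive p (- n%:R))
    @[n --> \oo] --> (0 : R).
Proof.
move=> p0; split=> /=.
  rewrite [X in _ --> X](_ : _ = pi / 2 + pi / 2 :> R); last by field.
  rewrite (_ : (fun n : nat => _) = (fun n : nat =>
    atan ((n%:R - Im p) / - Re p) + atan ((n%:R + Im p) / - Re p))); last first.
    apply/funext => n; rewrite -atanN; congr (_ + atan _).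
    by rewrite -mulNr; congr (_ / _); ring.
  have a0 : 0 < - Re p by rewrite oppr_gt0.
  apply: cvgD; apply: (cvg_comp _ _ (cvgy_affine _ a0)); exact: cvgy_atan.
have [C C0 hC] := sqdistV_le p0.
(* [u n] is [sqdist p (- n) / sqdist p n - 1], as the two squared distances differ by [4 n Im p].
   The constant for [u n ^+ 2] below comes from squaring this and using [n^2 <= 1 + n^2]. *)
pose u (n : nat) : R := 4 * n%:R * Im p / sqdist p n%:R.
have u0 : u n @[n --> \oo] --> (0 : R).
  apply: (@cvg0_sqr_le _ (16 * Im p ^+ 2 * C ^+ 2)) => n.
  rewrite /u exprMn exprVn.
  have D0 := sqdist_gt0 n%:R p0.
  have v0 : 0 <= (1 + n%:R ^+ 2 : R)^-1 by rewrite invr_ge0 ltW ?onePsqr_gt0.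
  have h : (sqdist p n%:R)^-1 ^+ 2 <= (C / (1 + n%:R ^+ 2)) ^+ 2.
    by rewrite lerXn2r ?nnegrE ?hC ?mulr_ge0 ?v0// invr_ge0 ltW.
  rewrite -exprVn (le_trans (ler_wpM2l _ h)) ?sqr_ge0//.
  have -> : (4 * n%:R * Im p) ^+ 2 * (C / (1 + n%:R ^+ 2)) ^+ 2 =
    16 * Im p ^+ 2 * C ^+ 2 / (1 + n%:R ^+ 2) * (n%:R ^+ 2 / (1 + n%:R ^+ 2)).
    by field; rewrite lt0r_neq0 ?onePsqr_gt0.
  rewrite ler_piMr ?ler_pdivrMr ?onePsqr_gt0 ?mul1r ?lerDr//.
  by rewrite mulr_ge0// mulr_ge0 ?sqr_ge0// mulr_ge0// sqr_ge0.
have -> : (fun n : nat => - (2^-1 * ln (sqdist p n%:R))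
    - - (2^-1 * ln (sqdist p (- n%:R)))) = (fun n => 2^-1 * ln (1 + u n)).
  apply/funext => n.
  have -> : 1 + u n = sqdist p (- n%:R) / sqdist p n%:R.
    have D0 := lt0r_neq0 (sqdist_gt0 n%:R p0).
    by rewrite /u; move: D0; rewrite /sqdist => D0; field.
  by rewrite ln_div ?posrE ?sqdist_gt0//; ring.
suff : 2^-1 * ln (1 + u n) @[n --> \oo] --> (2^-1 * ln 1 : R).
  by rewrite ln1 mulr0.
apply: cvgM; first exact: cvg_cst.
apply: continuous_cvg; first by apply: continuous_ln.
rewrite -[X in _ --> X](addr0 (1 : R)); apply: cvgD => //; exact: cvg_cst.
Qed.
End ResolventFunctions.

(** * Products of resolvents and partial fractions *)

Section StableRationalFunctions.
Variable R : realType.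
Local Notation Re := (@complex.Re R).
Local Notation Im := (@complex.Im R).
Implicit Types (f g : R -> R[i]) (p q z : R[i]).

Lemma resolvent_neq0 p w : Re p < 0 -> (0 +i* w)%C - p != 0.
Proof.
move=> p0; rewrite subr_eq0; apply/eqP => e; move: p0.
by rewrite -e /= ltxx.
Qed.

Lemma mul_resolvent p w : Re p < 0 -> ((0 +i* w)%C - p) * resolvent p w = 1.
Proof. by move=> p0; rewrite /resolvent mulfV// resolvent_neq0. Qed.

Lemma resolventB p q w : Re p < 0 -> Re q < 0 ->
  resolvent p w - resolvent q w = (p - q) * (resolvent p w * resolvent q w).
Proof.
move=> p0 q0; rewrite /resolvent.
by field; rewrite !resolvent_neq0.
Qed.

(** By the resolvent identity the difference decays quadratically although each term decays only
    linearly; the two increments [pi] of the primitives cancel. *)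
Lemma zero_integralC_resolventB p q : Re p < 0 -> Re q < 0 ->
  zero_integralC (fun w => resolvent p w - resolvent q w).
Proof.
move=> p0 q0.
have -> : (fun w => resolvent p w - resolvent q w) =
    (fun w => 1 * resolvent p w + -1 * resolvent q w).
  by apply/funext => w; rewrite mul1r mulN1r.
have [p1 p2] := resolvent_primitive_cvg p0.
have [q1 q2] := resolvent_primitive_cvg q0.
apply: zero_integralC_FTC
  (is_deriveC_linear 1 (-1) (is_deriveC_resolvent p0) (is_deriveC_resolvent q0))
  (is_deriveC_linear 1 (-1) (is_deriveC_resolvent_primitive p0)
    (is_deriveC_resolvent_primitive q0)) _ _.
- under [X in sqdecay _ X]funext do rewrite mul1r mulN1r resolventB//.
  apply: (@sqdecayM _ 0 2); first exact: sqdecay_cst.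
  by apply: (@sqdecayM _ 1 1); exact: sqdecay_resolvent.
- rewrite [X in X @ _](_ : _ = (fun n : nat =>
      (Re (resolvent_primitive p n%:R) - Re (resolvent_primitive p (- n%:R))) -
      (Re (resolvent_primitive q n%:R) - Re (resolvent_primitive q (- n%:R))))).
    by rewrite -(subrr pi); exact: cvgB p1 q1.
  by apply/funext => n; rewrite !mul1r !mulN1r !Re_add !Re_opp; ring.
- rewrite [X in X @ _](_ : _ = (fun n : nat =>
      (Im (resolvent_primitive p n%:R) - Im (resolvent_primitive p (- n%:R))) -
      (Im (resolvent_primitive q n%:R) - Im (resolvent_primitive q (- n%:R))))).
    by rewrite -(subrr 0); exact: cvgB p2 q2.
  by apply/funext => n; rewrite !mul1r !mulN1r !Im_add !Im_opp; ring.
Qed.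

(* Vanishing of the integral is not obviously preserved by multiplication with
   a resolvent; membership in this span is. *)
Inductive residue_free : (R -> R[i]) -> Prop :=
| residue_free_resolventB p q : Re p < 0 -> Re q < 0 ->
    residue_free (fun w => resolvent p w - resolvent q w)
| residue_free_resolventX p n : Re p < 0 ->
    residue_free (fun w => resolvent p w ^+ n.+2)
| residue_free_linear a b f g : residue_free f -> residue_free g ->
    residue_free (fun w => a * f w + b * g w).

Lemma residue_free_zero_integralC f : residue_free f -> zero_integralC f.
Proof.
elim=> *; [exact: zero_integralC_resolventB|exact: zero_integralC_resolventX|].
exact: zero_integralC_linear.
Qed.

(** For [p != q] the resolvent identity, applied to one factor of each kind, lowers the exponent of
    [resolvent q] by one and leaves a pure power. *)
Lemma residue_free_resolvent_mulX p q n : Re p < 0 -> Re q < 0 ->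
  residue_free (fun w => resolvent p w * resolvent q w ^+ n.+1).
Proof.
move=> p0 q0; have [->|pq] := eqVneq p q.
  under [X in residue_free X]funext do rewrite -exprS.
  exact: residue_free_resolventX.
have pq0 : p - q != 0 by rewrite subr_eq0.
have E w : resolvent p w * resolvent q w =
    (p - q)^-1 * (resolvent p w - resolvent q w).
  by rewrite resolventB// mulKf.
elim: n => [|n IHn].
  rewrite [X in residue_free X](_ : _ = (fun w =>
      (p - q)^-1 * (resolvent p w - resolvent q w) +
      0 * (resolvent p w - resolvent q w))).
    by apply: residue_free_linear; exact: residue_free_resolventB.
  by apply/funext => w; rewrite mul0r addr0 expr1 E.
rewrite [X in residue_free X](_ : _ = (fun w =>
    (p - q)^-1 * (resolvent p w * resolvent q w ^+ n.+1) +
    - (p - q)^-1 * resolvent q w ^+ n.+2)).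
  by apply: residue_free_linear => //; exact: residue_free_resolventX.
by apply/funext => w; rewrite (exprS _ n.+1) !mulrA E; ring.
Qed.

Lemma residue_free_resolvent_mul p f : Re p < 0 -> residue_free f ->
  residue_free (fun w => resolvent p w * f w).
Proof.
move=> p0; elim=> [q r q0 r0|q n q0|a b {}f g _ IHf _ IHg].
- rewrite [X in residue_free X](_ : _ = (fun w =>
      1 * (resolvent p w * resolvent q w ^+ 1) +
      -1 * (resolvent p w * resolvent r w ^+ 1))).
    by apply: residue_free_linear; exact: residue_free_resolvent_mulX.
  by apply/funext => w; ring.
- exact: residue_free_resolvent_mulX.
- rewrite [X in residue_free X](_ : _ = (fun w =>
      a * (resolvent p w * f w) + b * (resolvent p w * g w))).
    exact: residue_free_linear.
  by apply/funext => w; ring.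
Qed.

(** The induction starts at two factors: the primitive of a single resolvent has limiting increment
    [pi], not 0. *)
Lemma residue_free_prod_resolvent (s : seq R[i]) : (1 < size s)%N ->
  {in s, forall p, Re p < 0} ->
  residue_free (fun w => \prod_(p <- s) resolvent p w).
Proof.
elim: s => [|p [|q s] IHs]// _ s0.
have p0 : Re p < 0 by apply: s0; rewrite mem_head.
under [X in residue_free X]funext do rewrite big_cons.
case: s => [|r s] in IHs s0 *.
  under [X in residue_free X]funext do rewrite big_seq1 -[resolvent q _]expr1.
  apply: residue_free_resolvent_mulX => //; apply: s0.
  by rewrite !inE eqxx orbT.
apply: residue_free_resolvent_mul => //; apply: IHs => // t ts.
by apply: s0; rewrite inE ts orbT.
Qed.

(** Dividing [n] by ['X - p] cancels one resolvent against the quotient and leaves the constant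
    [n.[p]] times the full product. *)
Lemma residue_free_horner_mul_prod (s : seq R[i]) (n : {poly R[i]}) :
  (size n < size s)%N -> {in s, forall p, Re p < 0} ->
  residue_free (fun w => n.[(0 +i* w)%C] * \prod_(p <- s) resolvent p w).
Proof.
elim: s n => [|p s IHs] n //= ns s0.
have p0 : Re p < 0 by apply: s0; rewrite mem_head.
have [s_nil|s_gt0] := posnP (size s).
  move: ns; rewrite s_nil ltnS leqn0 size_poly_eq0 => /eqP ->.
  (* With one pole the size bound forces [n = 0]; the zero function is a generator with [q = p]. *)
  rewrite [X in residue_free X](_ : _ = (fun w => resolvent p w - resolvent p w)).
    exact: residue_free_resolventB.
  by apply/funext => w; rewrite horner0 mul0r subrr.
pose q := n %/ ('X - p%:P).
have n_eq : n = q * ('X - p%:P) + n.[p]%:P.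
  by rewrite -modp_XsubC; exact: divp_eq.
rewrite [X in residue_free X](_ : _ = (fun w =>
    1 * (q.[(0 +i* w)%C] * \prod_(t <- s) resolvent t w) +
    n.[p] * \prod_(t <- p :: s) resolvent t w)).
  apply: residue_free_linear.
    apply: IHs => [|t ts]; last by apply: s0; rewrite inE ts orbT.
    rewrite size_divp ?polyXsubC_eq0// size_XsubC subn1.
    by case: (size n) ns => // k; rewrite ltnS.
  exact: residue_free_prod_resolvent.
apply/funext => w; rewrite [in LHS]n_eq !hornerE big_cons.
have /= E := mul_resolvent w p0; rewrite mulrDl; congr (_ + _).
by rewrite -mulrA (mulrA _ (resolvent p w)) E mul1r.
Qed.
End StableRationalFunctions.

(** * Rational functions and their reduced fractions *)

Section Representatives.
Variable R : realType.
Implicit Types (H : ratfun R) (p q : {poly R[i]}) (z : R[i]).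
Local Notation "p %:F" := (rat_of_poly p) (at level 1, format "p %:F").

Lemma rat_of_polyD p q : (p + q)%:F = p%:F + q%:F.
Proof. exact: tofracD. Qed.

Lemma rat_of_polyB p q : (p - q)%:F = p%:F - q%:F.
Proof. exact: tofracB. Qed.

Lemma rat_of_polyM p q : (p * q)%:F = p%:F * q%:F.
Proof. exact: tofracM. Qed.

Lemma rat_of_poly_eq0 p : (p%:F == 0) = (p == 0).
Proof. exact: tofrac_eq0. Qed.

Lemma rat_of_poly_inj : injective (@rat_of_poly R).
Proof. by move=> p q /eqP; rewrite /rat_of_poly tofrac_eq => /eqP. Qed.

(** The quotient construction of the fraction field is opened here, reducing the identity to cross
    multiplication of representatives. *)
Lemma mul_den_repr H : H * ((frac (repr H)).2)%:F = ((frac (repr H)).1)%:F.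
Proof.
rewrite -{1}[H]reprK /rat_of_poly; case: (repr H) => -[n d] /= d0.
unlock FracField.tofrac; rewrite !piE; apply/eqmodP.
rewrite /= FracField.equivfE /FracField.mulf /= !numden_Ratio ?oner_eq0 ?mulr1//.
by rewrite mulrC.
Qed.

Lemma gcdp_repr_neq0 H : gcdp (frac (repr H)).1 (frac (repr H)).2 != 0.
Proof. by rewrite gcdp_eq0 negb_and (denom_ratioP (repr H)) orbT. Qed.

Lemma rat_den_neq0 H : rat_den H != 0.
Proof. by rewrite /rat_den dvdp_div_eq0 ?denom_ratioP ?dvdp_gcdr. Qed.

Lemma mul_rat_den H : H * (rat_den H)%:F = (rat_num H)%:F.
Proof.
have g0 := gcdp_repr_neq0 H.
have := mul_den_repr H.
rewrite -{1}(divpK (dvdp_gcdr (frac (repr H)).1 (frac (repr H)).2)).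
rewrite -{3}(divpK (dvdp_gcdl (frac (repr H)).1 (frac (repr H)).2)).
rewrite !rat_of_polyM mulrA; apply: mulIf.
by rewrite rat_of_poly_eq0.
Qed.

Lemma coprimep_rat_num_den H : coprimep (rat_num H) (rat_den H).
Proof.
by rewrite /rat_num /rat_den coprimep_div_gcd// (denom_ratioP (repr H)) orbT.
Qed.

(** * Poles, values and properness read off a possibly unreduced fraction [p/q] *)

Section Fraction.
Variables (H : ratfun R) (p q : {poly R[i]}).
Hypothesis Hq : H * q%:F = p%:F.

Lemma rat_num_cross : rat_num H * q = p * rat_den H.
Proof.
apply: rat_of_poly_inj; rewrite !rat_of_polyM -Hq -mul_rat_den; ring.
Qed.

(** If the reduced denominator vanished at [z], cross multiplication would make the reduced
    numerator vanish there too, against coprimality. *)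
Lemma rat_den_horner_neq0 z : q.[z] != 0 -> (rat_den H).[z] != 0.
Proof.
move=> qz; apply/negP => dz.
have := coprimep_root (coprimep_rat_num_den H).
have /(congr1 (fun t => t.[z])) := rat_num_cross.
rewrite !hornerM (eqP dz) mulr0 => /eqP; rewrite mulf_eq0 (negbTE qz) orbF => nz.
by move=> /(_ z nz); rewrite dz.
Qed.

Lemma rat_eval_fraction z : q.[z] != 0 -> rat_eval H z = p.[z] / q.[z].
Proof.
move=> qz; have dz := rat_den_horner_neq0 qz.
apply/eqP; rewrite /rat_eval eqr_div//; apply/eqP.
by have /(congr1 (fun t => t.[z])) := rat_num_cross; rewrite !hornerM.
Qed.

(** Cross multiplication equates the differences of degrees; zero numerators are treated apart, as
    [size_mul] requires nonzero factors. *)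
Lemma strictly_proper_fraction : q != 0 ->
  strictly_proper H <-> (size p < size q)%N.
Proof.
move=> q0; rewrite /strictly_proper.
have d0 := rat_den_neq0 H; have := rat_num_cross.
have [->|n0] := eqVneq (rat_num H) 0.
  rewrite mul0r => /esym/eqP; rewrite mulf_eq0 (negbTE d0) orbF => /eqP ->.
  by rewrite size_poly0 !size_poly_gt0 d0 q0.
have [->|p0] := eqVneq p 0.
  by move/eqP; rewrite mul0r mulf_eq0 (negbTE n0) (negbTE q0).
move/(congr1 (size \o polyseq)) => /=; rewrite !size_mul//.
move: n0 p0 q0 d0; rewrite -!size_poly_gt0.
by move: (size _) (size q) (size p) (size _) => *; split; lia.
Qed.

Lemma RH2_fraction : (forall z, 0 <= complex.Re z -> q.[z] != 0) ->
  (size p < size q)%N -> RH2 H.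
Proof.
move=> qz pq; split.
  apply/strictly_proper_fraction => //.
  by apply: contraTneq pq => ->; rewrite size_poly0.
by move=> z z0; apply/negP/rat_den_horner_neq0/qz.
Qed.
End Fraction.

Lemma H2norm_weighted_col (c : R) (Phi : ratfun R * ratfun R) :
  H2norm (block_mx (rat_const c)%:M 0 0 1%:M
          *m col_mx Phi.1%:M Phi.2%:M : 'M[ratfun R]_(1 + 1, 1)) =
  ((((2 * pi)^-1)%:E * \int[@lebesgue_measure R]_w
     (sqnorm (rat_eval (rat_const c * Phi.1) (0 +i* w)%C) +
      sqnorm (rat_eval Phi.2 (0 +i* w)%C))%:E) `^ 2^-1)%E.
Proof.
rewrite /H2norm; congr ((_ * _) `^ _)%E; apply: eq_integral => w _.
rewrite mul_block_col !mul0mx !mul1mx addr0 add0r /frobenius_sqr /freq_response.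
rewrite -scalar_mxM !map_col_mx tr_col_mx mul_row_col mxtraceD !trace_mx11.
rewrite !mxE !big_ord1 !mxE !eqxx !mulr1n.
by case: (rat_eval _ _) => a b; case: (rat_eval _ _) => u v; congr EFin;
  rewrite /sqnorm /=; ring.
Qed.
End Representatives.

(** * Stable fractions of relative degree at least 2, and two analytic facts about the excess
    cost *)

Lemma zero_integralC_stable (R : realType) (n d : {poly R[i]}) :
  (forall z, 0 <= complex.Re z -> d.[z] != 0) -> (size n < (size d).-1)%N ->
  zero_integralC (fun w : R => n.[(0 +i* w)%C] / d.[(0 +i* w)%C]).
Proof.
(* Over [R[i]], [d] splits into linear factors; by [dz] the roots lie in the open left half plane,
   so [1/d] is a scaled product of resolvents. *)
move=> dz nd; have [s ds] := closed_field_poly_normal d.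
have d0 : d != 0 by apply: contraTneq nd => ->; rewrite size_poly0.
have lead0 : lead_coef d != 0 by rewrite lead_coef_eq0.
have size_s : size s = (size d).-1.
  by rewrite ds size_scale// size_prod_XsubC.
have s0 : {in s, forall p, complex.Re p < 0}.
  move=> p ps; rewrite ltNge; apply/negP => /dz.
  by rewrite ds hornerZ (eqP (_ : root _ p)) ?root_prod_XsubC// mulr0 eqxx.
have E w : n.[(0 +i* w)%C] / d.[(0 +i* w)%C] = (lead_coef d)^-1 *
    (n.[(0 +i* w)%C] * \prod_(p <- s) resolvent p w).
  rewrite [in LHS]ds hornerZ horner_prod invfM mulrCA; congr (_ * (_ * _)).
  rewrite -prodfV; apply: eq_bigr => p _.
  by rewrite hornerXsubC.
rewrite -size_s in nd.
have zn := residue_free_zero_integralC (residue_free_horner_mul_prod nd s0).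
have := zero_integralC_linear (lead_coef d)^-1 0 zn zn.
by congr zero_integralC; apply/funext => w; rewrite mul0r addr0 E.
Qed.

(** Squaring gains a factor [1 + w^2] of decay and the weight costs one:
    [w^2 + c^2 <= (1 + c^2) (1 + w^2)]. *)
Lemma quad_decay_weighted_sqr (R : realType) (c : R) (f : R -> R) :
  quad_decay f -> quad_decay (fun w => (w ^+ 2 + c ^+ 2) * f w ^+ 2).
Proof.
move=> [cf [C fC]]; split.
  move=> w; apply: cvgM; last by rewrite /= expr2; apply: cvgM; exact: cf.
  by apply: cvgD; [exact: exprn_continuous|exact: cvg_cst].
exists ((1 + c ^+ 2) * C ^+ 2) => w; have D0 := onePsqr_gt0 w.
have c0 : 0 <= w ^+ 2 + c ^+ 2 by rewrite addr_ge0 ?sqr_ge0.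
rewrite (ger0_norm (mulr_ge0 c0 (sqr_ge0 (f w)))).
have fw : f w ^+ 2 <= (C / (1 + w ^+ 2)) ^+ 2.
  have := fC w; rewrite -ler_sqr ?nnegrE ?(le_trans _ (fC w))//.
  by rewrite real_normK ?num_real.
apply: (@le_trans _ _ ((1 + c ^+ 2) * (1 + w ^+ 2) * (C / (1 + w ^+ 2)) ^+ 2)).
  rewrite ler_pM ?addr_ge0 ?sqr_ge0//.
  have := sqr_ge0 c; have := sqr_ge0 w; nra.
rewrite le_eqVlt; apply/orP; left; apply/eqP.
by field; rewrite lt0r_neq0.
Qed.

(** A nonzero [m] has finitely many zeros on the axis; together with the negligible complement they
    would make the whole line null. *)
Lemma eq0_negligible_horner (R : realType) (m : {poly R[i]}) :
  {ae @lebesgue_measure R, forall w, m.[(0 +i* w)%C] = 0} -> m = 0.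
Proof.
move=> aem; apply/eqP/negP => /negP m0.
pose Z : set R := [set w | m.[(0 +i* w)%C] = 0].
have finZ : finite_set Z.
  have [s ms] := closed_field_poly_normal m.
  apply: (@sub_finite_set _ _ [set` map (@complex.Im R) s]) => [w|];
    last exact: finite_seq.
  rewrite /Z/= => mw; apply/mapP; exists (0 +i* w)%C => //.
  move/eqP: mw; rewrite ms hornerZ mulf_eq0 lead_coef_eq0 (negbTE m0)/=.
  by rewrite -[_ == 0]/(root _ _) root_prod_XsubC.
have Z0 : (@lebesgue_measure R).-negligible Z.
  exists Z; split => //; first exact: countable_measurable (finite_set_countable finZ).
  exact: countable_lebesgue_measure0 (finite_set_countable finZ).
have /(negligibleP _ measurableT) muT : (@lebesgue_measure R).-negligible setT.
  apply: negligibleS (negligibleU aem Z0) => w _ /=.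
  by have [Zw|Zw] := pselect (Z w); [right|left].
have := lebesgue_measure_itv (`]-oo, +oo[ : interval R).
by rewrite set_itvNyy muT.
Qed.

(** * Cost of a feasible pair compared with the candidate optimum *)

Section OptimalTransferFunction.
Variables (R : realType) (a c r : R).
Hypotheses (r_gt0 : 0 < r) (r_sqr : r ^+ 2 = c ^+ 2 + a ^+ 2).
Local Notation mu := (@lebesgue_measure R).
Local Notation Re := (@complex.Re R).
Local Notation Im := (@complex.Im R).
Local Notation "p %:F" := (rat_of_poly p) (at level 1, format "p %:F").
Local Notation "x %:C" := (real_complex R x).
Local Notation jw w := (0 +i* w)%C.
Local Notation den0 := ('X + r%:C%:P).

Definition cost (Phi : ratfun R * ratfun R) (w : R) : R :=
  sqnorm (rat_eval (rat_const c * Phi.1) (jw w)) + sqnorm (rat_eval Phi.2 (jw w)).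

Definition feasible (Phi : ratfun R * ratfun R) : Prop :=
  [/\ RH2 Phi.1, RH2 Phi.2 & ('X + a%:C%:P)%:F * Phi.1 - Phi.2 = 1].

Definition optimum : ratfun R * ratfun R :=
  ((rat_s + rat_const r)^-1, rat_const (a - r) / (rat_s + rat_const r)).

Lemma horner_den0_neq0 z : 0 <= Re z -> den0.[z] != 0.
Proof.
move=> z0; rewrite hornerD hornerX hornerC eq_complex negb_and; apply/orP; left.
by rewrite gt_eqF// Re_add /= ltr_wpDl.
Qed.

Lemma den0_neq0 : den0%:F != 0.
Proof. by rewrite rat_of_poly_eq0 -size_poly_eq0 size_XaddC. Qed.

Lemma den0E : rat_s + rat_const r = den0%:F.
Proof. by rewrite rat_of_polyD. Qed.

Lemma optimum1_den0 : optimum.1 * den0%:F = 1%:F.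
Proof. by rewrite /optimum /= den0E mulVf ?den0_neq0// /rat_of_poly tofrac1. Qed.

Lemma optimum2_den0 : optimum.2 * den0%:F = ((a - r)%:C%:P)%:F.
Proof. by rewrite /optimum /= den0E divfK ?den0_neq0. Qed.

Lemma feasible_optimum : feasible optimum.
Proof.
split.
- apply: (RH2_fraction optimum1_den0); first exact: horner_den0_neq0.
  by rewrite size_poly1 size_XaddC.
- apply: (RH2_fraction optimum2_den0); first exact: horner_den0_neq0.
  by rewrite size_XaddC ltnS size_polyC_leq1.
apply: (mulIf den0_neq0).
rewrite mulrBl -mulrA optimum1_den0 optimum2_den0 mul1r -rat_of_polyM -rat_of_polyB.
by rewrite mulr1 rmorphB/= polyCB; congr rat_of_poly; ring.
Qed.

Lemma RH2_den_neq0 (H : ratfun R) z : RH2 H -> 0 <= Re z -> (rat_den H).[z] != 0.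
Proof. by move=> [_ hp] /hp /negP. Qed.

Section Deviation.
Variables (Phi : ratfun R * ratfun R) (Phi_feasible : feasible Phi).

(** Numerator of [h = Phi.1 - 1/(s + r)] over the common denominator [dev_den], without
    reduction. *)
Definition dev_num : {poly R[i]} := rat_num Phi.1 * den0 - rat_den Phi.1.
Definition dev_den : {poly R[i]} := rat_den Phi.1 * den0.
Definition dev (w : R) : R[i] := dev_num.[jw w] / dev_den.[jw w].

(** The constraint writes [Phi.2] over the denominator of [Phi.1], so strict properness of [Phi.2]
    bounds the size of this numerator. *)
Lemma feasible2_den :
  Phi.2 * (rat_den Phi.1)%:F =
  (('X + a%:C%:P) * rat_num Phi.1 - rat_den Phi.1)%:F.
Proof.
have [_ _ aff] := Phi_feasible.
have -> : Phi.2 = ('X + a%:C%:P)%:F * Phi.1 - 1 by rewrite -aff; ring.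
by rewrite mulrBl -mulrA mul_rat_den mul1r rat_of_polyB rat_of_polyM.
Qed.

Lemma size_dev_num : (size dev_num < (size dev_den).-1)%N.
Proof.
have [[H1 _] [H2 _] _] := Phi_feasible.
have d0 := rat_den_neq0 Phi.1.
have {H2} s2 := (strictly_proper_fraction feasible2_den d0).1 H2.
rewrite /dev_den size_mul// -?size_poly_eq0 ?size_XaddC// addn2/=.
(* Strict properness of [Phi.2] bounds the first summand and that of [Phi.1] the second, both below
   the size of [rat_den Phi.1]; [dev_den] has one degree more. *)
have -> : dev_num = (('X + a%:C%:P) * rat_num Phi.1 - rat_den Phi.1) +
    (r - a)%:C%:P * rat_num Phi.1.
  by rewrite /dev_num rmorphB/= polyCB; ring.
apply: leq_ltn_trans (size_polyD _ _) _; rewrite gtn_max s2/=.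
rewrite mul_polyC; exact: leq_ltn_trans (size_scale_leq _ _) H1.
Qed.

Lemma dev_den_neq0 z : 0 <= Re z -> dev_den.[z] != 0.
Proof.
have [H1 _ _] := Phi_feasible => z0.
by rewrite hornerM mulf_neq0 ?horner_den0_neq0// RH2_den_neq0.
Qed.

Lemma zero_integralC_dev : zero_integralC dev.
Proof. exact: zero_integralC_stable dev_den_neq0 size_dev_num. Qed.

Lemma cost_dev w : cost Phi w =
  cost optimum w + (2 * (r - a) * Re (dev w) +
  ((w ^+ 2 + r ^+ 2) * Re (dev w) ^+ 2 + (w ^+ 2 + r ^+ 2) * Im (dev w) ^+ 2)).
Proof.
have [H1 _ _] := Phi_feasible.
have jw0 : 0 <= Re (jw w) by [].
have dz := RH2_den_neq0 H1 jw0.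
have dz0 := horner_den0_neq0 jw0.
have constM (H : ratfun R) p q : H * q%:F = p%:F ->
    rat_const c * H * q%:F = (c%:C%:P * p)%:F.
  by move=> e; rewrite -mulrA e rat_of_polyM.
rewrite /cost (rat_eval_fraction (constM _ _ _ (mul_rat_den Phi.1)) dz).
rewrite (rat_eval_fraction feasible2_den dz).
rewrite (rat_eval_fraction (constM _ _ _ optimum1_den0) dz0).
rewrite (rat_eval_fraction optimum2_den0 dz0) /dev /dev_num /dev_den.
rewrite !(hornerD, hornerN, hornerM, hornerX, hornerC) in dz dz0 *.
set n := (rat_num _).[_]; set d := (rat_den _).[_] in dz *.
set s := jw w + r%:C in dz0 *.
have -> : (n * s - d) / (d * s) = n / d - s^-1 by field; rewrite dz dz0.
have -> : c%:C * n / d = c%:C * s^-1 + c%:C * (n / d - s^-1).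
  by rewrite mulrBr mulrA addrC subrK.
have -> : ((jw w + a%:C) * n - d) / d =
    (a - r)%:C * s^-1 + (jw w + a%:C) * (n / d - s^-1).
  have -> : (a - r)%:C = a%:C - r%:C by rewrite rmorphB.
  have -> : jw w = s - r%:C by rewrite /s addrK.
  by field; rewrite dz dz0.
have st : s * s^-1 = 1 by rewrite mulfV.
have {st} [st1 st2] : r * Re s^-1 - w * Im s^-1 = 1 /\ r * Im s^-1 + w * Re s^-1 = 0.
  have := congr1 Re st; have := congr1 Im st.
  rewrite Re_mul Im_mul /s !(Re_add, Im_add) /=.
  by rewrite add0r addr0.
have c2 : c ^+ 2 = r ^+ 2 - a ^+ 2 by rewrite r_sqr addrK.
move: (s^-1) (n / d - s^-1) st1 st2 => t h st1 st2.
rewrite mulr1 /sqnorm !(Re_add, Im_add, Re_mul, Im_mul) /=.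
(* Here [t = 1/s] with [s = jw + r]. Since [c^2 = (r - a)(r + a)], the cross terms carry
   [c^2 + (a - r)(jw + a) = (r - a)(r - jw)], that is [r - a] times the conjugate of [s]; then
   [s t = 1] leaves [Re h]. *)
transitivity (c ^+ 2 * (Re t ^+ 2 + Im t ^+ 2) +
  (a - r) ^+ 2 * (Re t ^+ 2 + Im t ^+ 2) +
  (2 * (r - a) * (Re h * (r * Re t - w * Im t) + Im h * (r * Im t + w * Re t)) +
  (w ^+ 2 + r ^+ 2) * (Re h ^+ 2 + Im h ^+ 2))); last first.
  by rewrite st1 st2; ring.
ring: c2.
Qed.

Definition excess (w : R) : R :=
  (w ^+ 2 + r ^+ 2) * Re (dev w) ^+ 2 + (w ^+ 2 + r ^+ 2) * Im (dev w) ^+ 2.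

Lemma excess_ge0 w : 0 <= excess w.
Proof. by rewrite addr_ge0// mulr_ge0 ?sqr_ge0// addr_ge0 ?sqr_ge0. Qed.

Lemma quad_decay_excess : quad_decay excess.
Proof.
have [[qRe _] [qIm _]] := zero_integralC_dev.
have := quad_decay_linear 1 1 (quad_decay_weighted_sqr r qRe)
  (quad_decay_weighted_sqr r qIm).
by congr quad_decay; apply/funext => w; rewrite !mul1r.
Qed.

Lemma dev_num0_optimum : dev_num = 0 -> Phi = optimum.
Proof.
move=> m0; have [_ _ aff] := Phi_feasible.
have [_ _ aff0] := feasible_optimum.
have e1 : Phi.1 = optimum.1.
  have d0 : (rat_den Phi.1)%:F != 0 by rewrite rat_of_poly_eq0 rat_den_neq0.
  apply: (mulIf den0_neq0); apply: (mulIf d0).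
  rewrite optimum1_den0 mulrAC mul_rat_den -!rat_of_polyM mul1r.
  by congr rat_of_poly; apply/eqP; rewrite -subr_eq0 -/dev_num m0.
have e2 : Phi.2 = optimum.2.
  by apply: oppr_inj; apply: (addrI (('X + a%:C%:P)%:F * Phi.1)); rewrite {2}e1 aff aff0.
by rewrite [LHS]surjective_pairing e1 e2.
Qed.

(** The weight is positive and [dev_den] has no zero on the axis, so the excess vanishes only at
    zeros of the polynomial [dev_num]. *)
Lemma excess_ae0_optimum : {ae mu, forall w, excess w = 0} -> Phi = optimum.
Proof.
move=> ae0; apply: dev_num0_optimum; apply: eq0_negligible_horner.
apply: (negligibleS _ ae0) => w /=; apply: contra_not => /eqP.
have wr : w ^+ 2 + r ^+ 2 != 0.
  by rewrite paddr_eq0 ?sqr_ge0// negb_and !sqrf_eq0 (gt_eqF r_gt0) orbT.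
rewrite /excess -mulrDr mulf_eq0 (negbTE wr)/= -/(sqnorm _) sqnorm_eq0.
by rewrite /dev mulf_eq0 invr_eq0 (negbTE (dev_den_neq0 _)) ?orbF// => /eqP.
Qed.

End Deviation.

Lemma Re_opp_r_lt0 : Re (- r%:C) < 0.
Proof. by rewrite Re_opp oppr_lt0. Qed.

(** Both entries of the optimum are constants times the resolvent at the closed-loop pole [-r]. *)
Lemma cost_optimum w :
  cost optimum w = (c ^+ 2 + (a - r) ^+ 2) / sqdist (- r%:C) w.
Proof.
have jw0 : 0 <= Re (jw w) by [].
have dz0 := horner_den0_neq0 jw0.
have e1 : rat_const c * optimum.1 * den0%:F = (c%:C%:P)%:F.
  by rewrite -mulrA optimum1_den0 -rat_of_polyM mulr1.
rewrite /cost (rat_eval_fraction e1 dz0) (rat_eval_fraction optimum2_den0 dz0).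
rewrite hornerD hornerX !hornerC -[r%:C in X in X^-1]opprK -/(resolvent _ w).
rewrite !sqnormM (sqnorm_resolvent _ Re_opp_r_lt0) -mulrDl; congr (_ / _).
by rewrite /sqnorm /= expr0n !addr0.
Qed.

Lemma quad_decay_cost_optimum : quad_decay (cost optimum).
Proof.
have p0 := Re_opp_r_lt0; have [C C0 hC] := sqdistV_le p0.
split.
  rewrite (_ : cost optimum = fun w =>
    (c ^+ 2 + (a - r) ^+ 2) * (sqdist (- r%:C) w)^-1);
    last exact/funext/cost_optimum.
  move=> w; apply: cvgM; first exact: cvg_cst.
  apply: cvgV; first by rewrite lt0r_neq0// sqdist_gt0.
  by apply: is_derive_continuous => v; exact: is_derive_sqdist.
exists ((c ^+ 2 + (a - r) ^+ 2) * C) => w.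
have k0 : 0 <= c ^+ 2 + (a - r) ^+ 2 by rewrite addr_ge0 ?sqr_ge0.
rewrite cost_optimum -mulrA ger0_norm ?ler_wpM2l// mulr_ge0//.
by rewrite invr_ge0 ltW ?sqdist_gt0.
Qed.

Lemma integral_cost Phi (Phi_feasible : feasible Phi) :
  (\int[mu]_w (cost Phi w)%:E =
   \int[mu]_w (cost optimum w)%:E + \int[mu]_w (excess Phi w)%:E)%E.
Proof.
have I0 := quad_decay_integrable quad_decay_cost_optimum.
have Ix := quad_decay_integrable (quad_decay_excess Phi_feasible).
have [[qRe intRe] _] := zero_integralC_dev Phi_feasible.
have IRe := integrableZl measurableT (2 * (r - a)) (quad_decay_integrable qRe).
under eq_integral do rewrite (cost_dev Phi_feasible) EFinD.
rewrite integralD//; last by under eq_fun do rewrite EFinD EFinM; exact: integrableD.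
under [X in (_ + X)%E]eq_integral do rewrite EFinD EFinM.
by rewrite integralD// integralZl ?quad_decay_integrable// intRe mule0 add0e.
Qed.

(** The integral of the excess is finite, hence a real [x]; being the integral of a nonnegative
    function, it is 0 only if the excess vanishes almost everywhere. *)
Lemma integral_cost_excess Phi (Phi_feasible : feasible Phi) :
  exists2 x : R, 0 <= x & (\int[mu]_w (cost Phi w)%:E =
    \int[mu]_w (cost optimum w)%:E + x%:E)%E /\ (x = 0 -> Phi = optimum).
Proof.
have Ix := quad_decay_integrable (quad_decay_excess Phi_feasible).
exists (fine (\int[mu]_w (excess Phi w)%:E)%E).
  by apply/fine_ge0/integral_ge0 => w _; rewrite lee_fin excess_ge0.
have xfin : (\int[mu]_w (excess Phi w)%:E)%E \is a fin_num.
  exact: integrable_fin_num Ix.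
rewrite fineK// -integral_cost//; split=> // x0.
have {xfin x0} i0 : (\int[mu]_w (excess Phi w)%:E = 0)%E by rewrite -[LHS]fineK// x0.
apply: excess_ae0_optimum => //.
have mx := measurable_int _ Ix.
have /(ae_eq_integral_abs _ measurableT mx) :
  (\int[mu]_w `|(EFin \o excess Phi) w| = 0)%E.
  by rewrite -[RHS]i0; apply: eq_integral => w _; rewrite /= ger0_norm ?excess_ge0.
move=> ae0; apply: (negligibleS _ ae0) => w /=; apply: contra_not.
by move=> /(_ I) [].
Qed.
End OptimalTransferFunction.

Theorem proposition1 (R : realType) (alpha gamma : R) (kappa : int)
    (alpha_gt0 : 0 < alpha) (gamma_gt0 : 0 < gamma) :
  let k : R := kappa%:~R in
  let r : R := Num.sqrt (gamma ^+ 2 + alpha ^+ 2 * k ^+ 4) in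
  argmin
    [set Phi : ratfun R * ratfun R |
      [/\ RH2 Phi.1, RH2 Phi.2 &
          ((rat_s + 1) - rat_const (- alpha * k ^+ 2 + 1)) * Phi.1 - Phi.2
          = 1]]
    (fun Phi : ratfun R * ratfun R =>
      H2norm (block_mx (rat_const gamma)%:M 0 0 1%:M
              *m col_mx Phi.1%:M Phi.2%:M : 'M[ratfun R]_(1 + 1, 1)))
  = [set ((rat_s + rat_const r)^-1,
          rat_const (alpha * k ^+ 2 - r) / (rat_s + rat_const r))].
Proof.
move=> k r; set a := alpha * k ^+ 2.
have r_gt0 : 0 < r.
  rewrite sqrtr_gt0 ltr_pwDl ?exprn_gt0//.
  by rewrite mulr_ge0 ?sqr_ge0// exprn_even_ge0.
have r_sqr : r ^+ 2 = gamma ^+ 2 + a ^+ 2.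
  rewrite sqr_sqrtr /a; first by ring.
  by rewrite addr_ge0 ?sqr_ge0// mulr_ge0 ?sqr_ge0// exprn_even_ge0.
set S := (X in argmin X _); set J := (X in argmin _ X).
(* The polynomial factor in the constraint simplifies to [s + a]. *)
have SE Phi : S Phi <-> feasible a Phi.
  rewrite /feasible; suff <- : rat_s + 1 - rat_const (- alpha * k ^+ 2 + 1) =
    rat_of_poly ('X + (real_complex R a)%:P) by [].
  have -> : rat_const (- alpha * k ^+ 2 + 1) = 1 - rat_const a.
    rewrite mulNr -/a addrC /rat_const rmorphB polyCB rat_of_polyB.
    by rewrite /rat_of_poly tofrac1.
  by rewrite rat_of_polyD -/(rat_const a) -/rat_s; ring.
pose c := (2 * pi)^-1 : R.
have c_gt0 : 0 < c by rewrite invr_gt0 mulr_gt0// pi_gt0.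
pose I0 := fine (\int[@lebesgue_measure R]_w (cost gamma (optimum a r) w)%:E)%E.
have intI0 : (\int[@lebesgue_measure R]_w (cost gamma (optimum a r) w)%:E = I0%:E)%E.
  rewrite fineK//; apply: integrable_fin_num => //.
  exact: quad_decay_integrable (quad_decay_cost_optimum a gamma r_gt0).
have I0_ge0 : 0 <= I0.
  apply/fine_ge0/integral_ge0 => w _.
  by rewrite lee_fin addr_ge0 ?sqnorm_ge0.
(* On feasible pairs the objective is a strictly increasing function of the excess [x], which gives
   both optimality and uniqueness. *)
have JE Phi : feasible a Phi -> exists2 x : R, 0 <= x &
    J Phi = ((c * (I0 + x)) `^ 2^-1)%:E /\ (x = 0 -> Phi = optimum a r).
  move=> /(integral_cost_excess r_gt0 r_sqr) [x x_ge0 [intx x0]]; exists x => //.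
  split=> //; rewrite /J H2norm_weighted_col intx intI0.
  by rewrite -EFinD -EFinM poweR_EFin.
have Jopt : J (optimum a r) = ((c * I0) `^ 2^-1)%:E.
  by rewrite /J H2norm_weighted_col intI0 -EFinM poweR_EFin.
apply/seteqP; split=> [Phi|_ ->].
  move=> [/SE fPhi minPhi].
  have [x x_ge0 [JPhi x0]] := JE _ fPhi; apply: x0; apply/eqP.
  have := minPhi _ ((SE _).2 (feasible_optimum a r_gt0)).
  (* A minimizer with [x != 0] would cost strictly more than the feasible optimum. *)
  apply: contraTT => xn0; rewrite JPhi Jopt -ltNge lte_fin.
  rewrite gt0_ltr_powR ?nnegrE ?mulr_ge0 ?addr_ge0 ?(ltW c_gt0)//.
  by rewrite ltr_pM2l// ltrDl lt_neqAle eq_sym xn0.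
split; first exact/SE/feasible_optimum.
move=> Phi /SE fPhi; have [x x_ge0 [-> _]] := JE _ fPhi.
rewrite Jopt lee_fin ge0_ler_powR ?nnegrE ?mulr_ge0 ?addr_ge0 ?(ltW c_gt0)//.
by rewrite ler_pM2l// lerDl.
Qed.
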